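(* Let $\Gamma$ be a finite connected simple graph with $r+1$ vertices and $n$ edges, where $r\ge 2$, let $F_\Gamma\in\mathbb{R}[x_1,\dots,x_n]$ be its Kirchhoff polynomial, and let $R_\Gamma^*=\bigoplus_{\ell=0}^r R_\Gamma^\ell=\mathbb{R}[x_1,\dots,x_n]/\mathrm{Ann}(F_\Gamma)$. Then for every $\boldsymbol{a}=(a_1,\dots,a_n)\in(\mathbb{R}_{>0})^n$, the element $L_{\boldsymbol{a}}:=a_1x_1+\cdots+a_nx_n\in R_\Gamma^1$ satisfies the strong Lefschetz property at degree one; that is, the multiplication map $$\times L_{\boldsymbol{a}}^{r-2}: R_\Gamma^1\to R_\Gamma^{r-1}$$ is an isomorphism.
   Context: For a finite connected graph $\Gamma=(V,E)$ with edges labelled $1,\dots,n$, the Kirchhoff polynomial is $F_\Gamma(x_1,\dots,x_n)=\sum_{T}\prod_{i\in T}x_i$, the sum over all spanning trees $T$ of $\Gamma$ (identified with their edge sets). For a homogeneous polynomial $F\in\mathbb{R}[x_1,\dots,x_n]$, $\mathrm{Ann}(F)=\{P\in\mathbb{R}[x_1,\dots,x_n] : P(\frac{\partial}{\partial x_1},\dots,\frac{\partial}{\partial x_n})F=0\}$, a homogeneous ideal; the quotient is graded by degree, and $R_\Gamma^\ell$ denotes its degree-$\ell$ part. *)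

(* Defs.v *)
From HB Require Import structures.
From mathcomp Require Import all_boot all_order all_algebra.
From mathcomp Require Import classical_sets functions reals.
From mathcomp Require Import ssrcomplements mpoly.

Set Implicit Arguments.
Unset Strict Implicit.
Unset Printing Implicit Defensive.

Import GRing.Theory.
Import Quotient.

Local Open Scope ring_scope.
Local Open Scope quotient_scope.

(* A graph on the vertex set V is given by its adjacency relation; it is     *)
(* simple when the relation is symmetric and irreflexive.                     *)
Definition connected_graph (V : finType) (e : rel V) : bool :=
  [forall x, forall y, connect e x y].

(* No cycle x_1, ..., x_k of pairwise distinct vertices with k >= 3; the      *)
(* bound k <= #|V| is harmless, the vertices being distinct.                  *)
Definition acyclic_graph (V : finType) (e : rel V) : bool :=
  [forall k : 'I_#|V|.+1, forall c : k.-tuple V,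
     (2 < k)%N ==> ~~ (cycle e c && uniq c)].

Definition is_tree (V : finType) (e : rel V) : bool :=
  connected_graph e && acyclic_graph e.

Definition edge_set (V : finType) (e : rel V) : {set {set V}} :=
  [set [set p.1; p.2] | p : V * V & e p.1 p.2].

(* The labels 1, ..., n are represented by 'I_n = {0, ..., n-1}.              *)
Definition edge_labelling (V : finType) (e : rel V) (n : nat)
    (lab : 'I_n -> {set V}) : Prop :=
  injective lab /\ [set lab i | i : 'I_n] = edge_set e.

(* Adjacency in the subgraph with all the vertices of V and, as edges, those  *)
(* labelled by an element of T.                                               *)
Definition subgraph_rel (V : finType) (n : nat) (lab : 'I_n -> {set V})
    (T : {set 'I_n}) : rel V :=
  [rel x y | [set x; y] \in [set lab i | i in T]].

Definition spanning_tree (V : finType) (n : nat) (lab : 'I_n -> {set V})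
    (T : {set 'I_n}) : bool :=
  is_tree (subgraph_rel lab T).

Definition kirchhoff (R : comNzRingType) (V : finType) (n : nat)
    (lab : 'I_n -> {set V}) : {mpoly R[n]} :=
  \sum_(T : {set 'I_n} | spanning_tree lab T) \prod_(i in T) 'X_i.

(* P(d/dx_1, ..., d/dx_n) F *)
Definition diffop (R : comNzRingType) (n : nat) (F P : {mpoly R[n]}) :
    {mpoly R[n]} :=
  \sum_(m <- msupp P) P@_m *: F^`M[m].

Definition ann (R : comNzRingType) (n : nat) (F : {mpoly R[n]}) :
    {pred {mpoly R[n]}} :=
  fun P => diffop F P == 0.

Section Annihilator.

Variables (R : comNzRingType) (n : nat) (F : {mpoly R[n]}).
Implicit Types P Q : {mpoly R[n]}.

Lemma diffopwE k P : (msize P <= k)%N ->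
  diffop F P = \sum_(m : 'X_{1..n < k}) P@_m *: F^`M[m].
Proof.
move=> leP; pose I : subFinType _ := 'X_{1..n < k}.
rewrite /diffop (big_mksub I) /=; first last.
- by move=> m /msize_mdeg_lt /leq_trans; apply.
- exact: msupp_uniq.
rewrite big_rmcond //= => m /memN_msupp_eq0 ->; exact: scale0r.
Qed.

Lemma diffop_is_linear : linear (diffop F).
Proof.
move=> c P Q; pose k := maxn (msize (c *: P + Q)) (maxn (msize P) (msize Q)).
rewrite !(@diffopwE k) ?leq_max ?leqnn ?orbT //.
rewrite scaler_sumr -big_split /=; apply: eq_bigr => m _.
by rewrite mcoeffD mcoeffZ scalerDl scalerA.
Qed.

HB.instance Definition _ := GRing.isLinear.Build R {mpoly R[n]} {mpoly R[n]} _
  (diffop F) diffop_is_linear.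

Lemma diffopX m : diffop F 'X_[m] = F^`M[m].
Proof. by rewrite /diffop msuppX big_seq1 mcoeffX eqxx scale1r. Qed.

End Annihilator.

Section AnnihilatorIdeal.

Variables (R : comNzRingType) (n : nat) (F : {mpoly R[n]}).
Implicit Types P Q : {mpoly R[n]}.

Lemma diffopM P Q : diffop F (P * Q) = diffop (diffop F Q) P.
Proof.
rewrite {1}[P]mpolyE mulr_suml raddf_sum /= [RHS]/diffop; apply: eq_bigr => m _.
rewrite -scalerAl linearZ /=; congr (_ *: _).
rewrite [Q in LHS]mpolyE mulr_sumr [LHS]raddf_sum /= [in RHS]/diffop.
rewrite [RHS]raddf_sum /=; apply: eq_bigr => m' _.
by rewrite -scalerAr !linearZ /= -mpolyXD diffopX addmC mderivmDm.
Qed.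

Lemma ann_zmod_closed : zmod_closed (ann F).
Proof.
split=> [|P Q]; rewrite !unfold_in; first by rewrite linear0.
by move=> /eqP hP /eqP hQ; rewrite linearB /= hP hQ subrr.
Qed.

HB.instance Definition _ :=
  GRing.isZmodClosed.Build {mpoly R[n]} (ann F) ann_zmod_closed.

Lemma annMl P Q : Q \in ann F -> P * Q \in ann F.
Proof.
rewrite !unfold_in diffopM => /eqP ->.
by rewrite /diffop big1 // => m _; rewrite linear0 scaler0.
Qed.

Lemma annZ c P : P \in ann F -> c *: P \in ann F.
Proof. by rewrite -mul_mpolyC; apply: annMl. Qed.

End AnnihilatorIdeal.

(* R[x_1, ..., x_n] / Ann(F).  The library endows the quotient of a ring by   *)
(* an ideal with a ring structure only when the ideal is proper, that is,     *)
(* when F != 0; the construction below makes no such restriction (the         *)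
(* quotient is the zero ring when F = 0).                                     *)
Definition apolar (R : comNzRingType) (n : nat) (F : {mpoly R[n]}) : Type :=
  {quot (ann F)}.

Section ApolarAlgebra.

Variables (R : comNzRingType) (n : nat) (F : {mpoly R[n]}).

Local Notation A := (apolar F).
Local Notation pi := (\pi_{quot (ann F)}).

HB.instance Definition _ := GRing.Zmodule.on A.
HB.instance Definition _ :=
  ZmodQuotient.copy A {quot (ann F)}.

Definition apolar_proj (P : {mpoly R[n]}) : A := pi P.

Lemma apolar_proj_eq P Q : (apolar_proj P == apolar_proj Q) = (P - Q \in ann F).
Proof. by rewrite idealrBE. Qed.

Definition apolar_one : A := apolar_proj 1.
Definition apolar_mul (x y : A) : A :=
  apolar_proj (repr x * repr y).
Definition apolar_scale (c : R) (x : A) : A := apolar_proj (c *: repr x).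

Lemma apolar_ind (T : A -> Prop) : (forall P, T (apolar_proj P)) -> forall x, T x.
Proof. by move=> h x; rewrite -[x]reprK; apply: h. Qed.

Lemma apolar_projD : {morph apolar_proj : P Q / P + Q}.
Proof. by move=> P Q; rewrite /apolar_proj !piE. Qed.

Lemma apolar_repr P : repr (apolar_proj P) - P \in ann F.
Proof. by rewrite idealrBE reprK. Qed.

Lemma apolar_projM P Q :
  apolar_proj (P * Q) = apolar_mul (apolar_proj P) (apolar_proj Q).
Proof.
apply/esym/eqP; rewrite apolar_proj_eq.
set P' := repr _; set Q' := repr _.
have -> : P' * Q' - P * Q = P' * (Q' - Q) + Q * (P' - P).
  by rewrite !mulrBr ![Q * _]mulrC addrA subrK.
by rewrite rpredD // annMl // apolar_repr.
Qed.

Lemma apolar_projZ c P : apolar_proj (c *: P) = apolar_scale c (apolar_proj P).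
Proof.
by apply/esym/eqP; rewrite apolar_proj_eq -scalerBr annZ // apolar_repr.
Qed.

Fact apolar_mulA : associative apolar_mul.
Proof.
by elim/apolar_ind=> P; elim/apolar_ind=> Q; elim/apolar_ind=> S;
   rewrite -!apolar_projM mulrA.
Qed.

Fact apolar_mulC : commutative apolar_mul.
Proof.
by elim/apolar_ind=> P; elim/apolar_ind=> Q; rewrite -!apolar_projM mulrC.
Qed.

Fact apolar_mul1 : left_id apolar_one apolar_mul.
Proof. by elim/apolar_ind=> P; rewrite -apolar_projM mul1r. Qed.

Fact apolar_mulDl : left_distributive apolar_mul +%R.
Proof.
by elim/apolar_ind=> P; elim/apolar_ind=> Q; elim/apolar_ind=> S;
   rewrite -apolar_projD -!apolar_projM mulrDl apolar_projD.
Qed.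

HB.instance Definition _ := GRing.Zmodule_isComPzRing.Build A
  apolar_mulA apolar_mulC apolar_mul1 apolar_mulDl.

Fact apolar_scaleA a b x :
  apolar_scale a (apolar_scale b x) = apolar_scale (a * b) x.
Proof. by elim/apolar_ind: x => P; rewrite -!apolar_projZ scalerA. Qed.

Fact apolar_scale1 : left_id 1 apolar_scale.
Proof. by elim/apolar_ind=> P; rewrite -apolar_projZ scale1r. Qed.

Fact apolar_scaleDr : right_distributive apolar_scale +%R.
Proof.
move=> c; elim/apolar_ind=> P; elim/apolar_ind=> Q.
by rewrite -apolar_projD -!apolar_projZ scalerDr apolar_projD.
Qed.

Fact apolar_scaleDl x : {morph apolar_scale^~ x : a b / a + b}.
Proof.
elim/apolar_ind: x => P a b.
by rewrite -!apolar_projZ scalerDl apolar_projD.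
Qed.

HB.instance Definition _ := GRing.Zmodule_isLmodule.Build R A
  apolar_scaleA apolar_scale1 apolar_scaleDr apolar_scaleDl.

Fact apolar_proj_is_linear : linear apolar_proj.
Proof. by move=> c P Q; rewrite apolar_projD apolar_projZ. Qed.

HB.instance Definition _ := GRing.isLinear.Build R {mpoly R[n]} A _
  apolar_proj apolar_proj_is_linear.

Fact apolar_proj_is_monoid_morphism : monoid_morphism apolar_proj.
Proof. by split=> // P Q; rewrite apolar_projM. Qed.

HB.instance Definition _ := GRing.isMonoidMorphism.Build {mpoly R[n]} A
  apolar_proj apolar_proj_is_monoid_morphism.

Lemma apolar_scaleAr c (x y : A) : c *: (x * y) = x * (c *: y).
Proof.
elim/apolar_ind: x => P; elim/apolar_ind: y => Q.
by rewrite -rmorphM -!linearZ -rmorphM -scalerAr.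
Qed.

(* The degree l part of R[x_1, ..., x_n] / Ann(F): the classes of the        *)
(* homogeneous polynomials of degree l.                                       *)
Definition apolar_part (l : nat) : set A :=
  (apolar_proj @` [set P | P \is l.-homog])%classic.

Definition mulmap (y : A) : A -> A := fun x => y * x.

Fact mulmap_is_linear y : linear (mulmap y).
Proof. by move=> c u v; rewrite /mulmap mulrDr apolar_scaleAr. Qed.

HB.instance Definition _ y := GRing.isLinear.Build R A A _
  (mulmap y) (mulmap_is_linear y).

Definition linear_form (a : 'I_n -> R) : A :=
  apolar_proj (\sum_(i < n) a i *: 'X_i).

End ApolarAlgebra.

Arguments apolar_part {R n} F l.
Arguments linear_form {R n} F a.

(* Main.v *)
Require Import Defs.
From mathcomp Require Import fingroup perm.
From mathcomp Require Import all_boot all_order all_algebra.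
From mathcomp Require Import classical_sets functions reals.
From mathcomp Require Import mpoly ring.

(** Write ell_b for the linear form with coefficients b, L = ell_a, and F for
    the Kirchhoff polynomial, homogeneous of degree r.  A class in degree one
    is represented by a form ell_x, and ell_x * L^(r-2) annihilates F exactly
    when x lies in the kernel of the Hessian of F at a, up to the factor
    (r-2)!.  Everything reduces to this Hessian being nondegenerate: that gives
    injectivity at once, and surjectivity because a class of degree r-1 is
    determined by the linear form to which it sends F, while an invertible
    n x n matrix reaches all the linear forms (lefschetz_of_hessian).

    Suppose that ell_x * L^(r-2) kills F.  Then so do ell_x * L^(r-1) and
    ell_x^2 * L^(r-2), and since ell_b^r sends F to r! F(b), the coefficients of
    t and t^2 in F(a + t x) vanish (line_coefs_eq0).

    By the matrix-tree theorem (matrix_tree), F(y) = det (B diag(y) B^T) with B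
    the incidence matrix with the row of one vertex deleted.  Hence
    F(a + t x) = det (G + t A), where G = B diag(a) B^T is positive definite and
    A = B diag(x) B^T is symmetric.  For M = G^-1 A the vanishing of the two
    coefficients gives tr (M^2) = 0 (mxtrace_sqr_eq0).  As M is similar to a
    symmetric matrix, this forces A = 0: this is the strict log-concavity of
    the determinant (det_line_rigid).  Finally A = 0 implies x = 0, because in a
    simple graph an edge is determined by its two ends, so that its weight can
    be read off the weighted Laplacian (laplacian_inj). *)

Set Implicit Arguments.
Unset Strict Implicit.
Unset Printing Implicit Defensive.

Import Order.TTheory GRing.Theory Num.Theory.

Local Open Scope ring_scope.

(** * Cauchy-Binet with diagonal weights *)

Definition indic_row (S : comNzRingType) (n : nat) (T : {set 'I_n}) : 'rV[S]_n :=
  \row_i (i \in T)%:R.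

Lemma det_mul_expand (S : comNzRingType) r n (B : 'M[S]_(r, n)) (x : 'rV[S]_n)
    (C : 'M[S]_(n, r)) :
  \det (B *m diag_mx x *m C) =
  \sum_(f : {ffun 'I_r -> 'I_n} | injectiveb f)
     (\prod_(i in [set f k | k : 'I_r]) x 0 i) *
     ((\prod_k B k (f k)) * \det (rowsub f C)).
Proof.
rewrite /determinant.
transitivity (\sum_(f : {ffun 'I_r -> 'I_n})
    ((\prod_k x 0 (f k)) * (\prod_k B k (f k))) * \det (rowsub f C)).
  under eq_bigr => s _.
    rewrite (eq_bigr (fun k => \sum_j B k j * x 0 j * C j (s k))); last first.
      move=> k _; rewrite mxE; apply: eq_bigr => j _; congr (_ * _).
      by rewrite mul_mx_diag mxE.
    rewrite bigA_distr_bigA mulr_sumr.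
    over.
  rewrite exchange_big; apply: eq_bigr => f _; rewrite mulr_sumr.
  apply: eq_bigr => s _; rewrite !big_split /= mulrCA.
  rewrite -(mulrC (\prod_k B k (f k))); congr (_ * (_ * _)).
  by apply: eq_bigr => k _; rewrite mxE.
rewrite (bigID (fun f : {ffun 'I_r -> 'I_n} => injectiveb f)) /= [X in _ + X]big1 ?addr0.
  apply: eq_bigr => f /injectiveP injf; rewrite -mulrA; congr (_ * _).
  by rewrite big_imset //= => u v _ _; apply: injf.
move=> f /injectivePn[i [j neq_ij eq_f]].
rewrite (determinant_alternate neq_ij) ?mulr0 // => k.
by rewrite !mxE eq_f.
Qed.

(** The coefficient of the monomial of T is itself written as a determinant of
    the same shape, with the weights 0 and 1: this avoids choosing an
    enumeration of each set T of columns to speak of the corresponding minors. *)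
Lemma cauchy_binet_diag (S : comNzRingType) r n (B : 'M[S]_(r, n))
    (x : 'rV[S]_n) (C : 'M[S]_(n, r)) :
  \det (B *m diag_mx x *m C) =
  \sum_(T : {set 'I_n} | #|T| == r)
     (\prod_(i in T) x 0 i) * \det (B *m diag_mx (indic_row S T) *m C).
Proof.
pose im (f : {ffun 'I_r -> 'I_n}) := [set f k | k : 'I_r].
have im_card (f : {ffun 'I_r -> 'I_n}) : injectiveb f -> #|im f| == r.
  by move/injectiveP=> injf; rewrite card_imset // card_ord.
rewrite det_mul_expand (partition_big im (fun T => #|T| == r)) //=.
apply: eq_bigr => T /eqP cT; rewrite det_mul_expand.
(* with 0-1 weights on T, only the maps onto T survive *)
rewrite [in RHS](bigID (fun f : {ffun 'I_r -> 'I_n} => im f == T)) /=.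
rewrite [X in _ * (_ + X)]big1 ?addr0.
  rewrite mulr_sumr; apply: eq_bigr => f /andP[_ /eqP imf].
  rewrite -/(im f) imf [X in _ = _ * (X * _)]big1 ?mul1r //.
  by move=> i iT; rewrite mxE iT.
move=> f /andP[injf imf].
have [i iim iT] : exists2 i, i \in im f & i \notin T.
  apply/subsetPn; apply: contra imf => sub.
  by rewrite eqEcard sub cT (eqP (im_card _ injf)) leqnn.
by rewrite (bigD1 i) //= mxE (negbTE iT) !mul0r.
Qed.

(** * Rigidity of the determinant along a line *)

Lemma coef1_prod_1addX (S : comNzRingType) (I : Type) (s : seq I) (d : I -> S) :
  (\prod_(i <- s) (1 + d i *: 'X))`_0 = 1 /\
  (\prod_(i <- s) (1 + d i *: 'X))`_1 = \sum_(i <- s) d i.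
Proof.
elim: s => [|i s [IH0 IH1]]; first by rewrite !big_nil !coef1.
rewrite !big_cons !mulrDl !mul1r -!scalerAl !coefD !coefZ !coefXM /= IH0 IH1.
by rewrite mulr0 addr0 mulr1 addrC.
Qed.


(** Modulo X^2 only the identity permutation contributes: any other one moves
    two points, hence picks two off-diagonal entries, both multiples of X. *)
Lemma coef_det_1addX (S : comNzRingType) r (N : 'M[S]_r) :
  (\det (1%:M + 'X *: map_mx polyC N))`_0 = 1 /\
  (\det (1%:M + 'X *: map_mx polyC N))`_1 = \tr N.
Proof.
have diag (i : 'I_r) : (1%:M + 'X *: map_mx polyC N) i i = 1 + N i i *: 'X.
  by rewrite !mxE eqxx mulrC mul_polyC.
have offdiag (i j : 'I_r) : i != j ->
    (1%:M + 'X *: map_mx polyC N) i j = 'X * (N i j)%:P.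
  by move=> /negbTE ne; rewrite !mxE ne add0r.
have [q ->] : exists q, \det (1%:M + 'X *: map_mx polyC N) =
    \prod_i (1 + N i i *: 'X) + q * 'X^2.
  rewrite /determinant (bigD1 1%g) //= odd_perm1 expr0 mul1r.
  rewrite (eq_bigr (fun i => 1 + N i i *: 'X)); last by move=> i _; rewrite perm1 diag.
  suff [q ->] : exists q, \sum_(s : 'S_r | s != 1%g)
      (-1) ^+ s * \prod_i (1%:M + 'X *: map_mx polyC N) i (s i) = q * 'X^2.
    by exists q.
  apply: (big_ind (fun p => exists q, p = q * 'X^2)).
  - by exists 0; rewrite mul0r.
  - by move=> _ _ [p ->] [q ->]; exists (p + q); rewrite mulrDl.
  move=> s s_neq1.
  (* i and s i are two distinct points moved by s *)
  have [i si] : exists i, s i != i.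
    apply/existsP; apply: contraR s_neq1 => /existsPn h.
    by apply/eqP/perm.permP => i; rewrite perm1; apply/eqP; have := h i; rewrite negbK.
  rewrite (bigD1 i) //= (bigD1 (s i)) //= !offdiag; first last.
  - by rewrite eq_sym.
  - by rewrite eq_sym (inj_eq perm_inj).
  set a := (N i _)%:P; set b := (N (s i) _)%:P; set c := \prod_(_ | _) _.
  exists ((-1) ^+ s * (a * (b * c))); rewrite expr2.
  by move: ((-1) ^+ s) => u; ring.
rewrite !coefD !coefMXn /= !addr0; exact: coef1_prod_1addX.
Qed.

(** With q(X) = det (1 + X M), the product q(X) q(-X) is det (1 - X^2 M^2), whose
    coefficient at X^2 is - tr (M^2); this trick yields the second power sum of
    the eigenvalues without a formula for the second coefficient of q. *)
Lemma mxtrace_sqr_eq0 (S : comNzRingType) r (M : 'M[S]_r)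
    (q := \det (1%:M + 'X *: map_mx polyC M)) :
  q`_1 = 0 -> q`_2 = 0 -> \tr (M *m M) = 0.
Proof.
move=> q1 q2; have [q0 _] := coef_det_1addX M.
pose N := - (M *m M).
have [_ trN] := coef_det_1addX N.
have compE (P : 'M[S]_r) (u : {poly S}) :
    \det (1%:M + 'X *: map_mx polyC P) \Po u = \det (1%:M + u *: map_mx polyC P).
  rewrite -det_map_mx map_mxD map_mx1 map_mxZ /= comp_polyX; congr (\det (_ + _ *: _)).
  by apply/matrixP=> i j; rewrite !mxE comp_polyC.
have eq_q : q * (q \Po (- 'X)) =
    (\det (1%:M + 'X *: map_mx polyC N)) \Po 'X^2.
  rewrite !compE -det_mulmx; congr (\det _).
  rewrite mulmxDl mul1mx mulmxDr mulmx1 -scalemxAl -scalemxAr scalerA -map_mxM.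
  rewrite scaleNr mulrN -expr2 scaleNr map_mxN scalerN addrACA.
  by rewrite addrA addrK.
have qE : q = 1 + drop_poly 3 q * 'X^3.
  rewrite -[LHS](poly_take_drop 3); congr (_ + _); apply/polyP=> -[|[|[|k]]];
    by rewrite coef_take_poly coef1 /= ?q1 ?q2.
move: trN eq_q; set p := \det (1%:M + _ *: map_mx polyC N) => trN eq_q.
have pE : p = (p`_0)%:P + p`_1 *: 'X + drop_poly 2 p * 'X^2.
  rewrite -[LHS](poly_take_drop 2); congr (_ + _); apply/polyP=> -[|[|k]];
    by rewrite coef_take_poly coefD coefC coefZ coefX /= ?mulr0 ?mulr1 ?addr0 ?add0r.
have rhs : (p \Po 'X^2)`_2 = p`_1.
  rewrite {1}pE !comp_polyD comp_polyM comp_polyZ comp_polyC comp_polyX comp_Xn_poly.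
  by rewrite -exprM !coefD coefZ coefC coefXn coefMXn /= mulr1 add0r addr0.
have lhs : (q * (q \Po - 'X))`_2 = 0.
  rewrite qE comp_polyD comp_polyM comp_Xn_poly comp_polyC.
  set u := drop_poly 3 q; set v := u \Po _.
  have -> : (1 + u * 'X^3) * (1%:P + v * (- 'X) ^+ 3) = 1 + (u - v - u * v * 'X^3) * 'X^3.
    by rewrite polyC1; ring.
  by rewrite coefD coef1 coefMXn addr0.
by move: lhs; rewrite eq_q rhs trN linearN => /eqP; rewrite oppr_eq0 => /eqP.
Qed.

Lemma mul_mx_tr_eq0 (R : realDomainType) m n (P : 'M[R]_(m, n)) :
  \tr (P *m P^T) = 0 -> P = 0.
Proof.
move=> trP; apply/matrixP=> i j; rewrite mxE; apply/eqP; rewrite -sqrf_eq0; apply/eqP.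
have trE : \tr (P *m P^T) = \sum_i \sum_j P i j ^+ 2.
  by apply: eq_bigr => k _; rewrite mxE; apply: eq_bigr => l _; rewrite mxE expr2.
move: trP; rewrite trE => /psumr_eq0P h.
have /psumr_eq0P h' := h (fun k _ => sumr_ge0 _ (fun l _ => sqr_ge0 _)) i isT.
by apply: h' => // l _; apply: sqr_ge0.
Qed.

Lemma gram_unit (R : realFieldType) m n (E : 'M[R]_(m, n)) :
  (forall y : 'rV_m, y *m E = 0 -> y = 0) -> E *m E^T \in unitmx.
Proof.
move=> injE; rewrite -row_free_unit -kermx_eq0; apply/eqP/row_matrixP=> i.
rewrite row0; apply: injE; apply: mul_mx_tr_eq0.
rewrite trmx_mul !mulmxA; set y := row i _.
have -> : y *m E *m E^T = 0 by rewrite -mulmxA /y -row_mul mulmx_ker row0.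
by rewrite mul0mx linear0.
Qed.

(** The matrix G^-1 A is not symmetric, but P = E^T (G^-1 A G^-1) E is, and both
    have the same trace of the square; a symmetric matrix whose square has trace
    zero vanishes, and A = E P E^T. *)
Lemma sym_trace_gram_eq0 (R : realFieldType) m n (E : 'M[R]_(m, n)) (A : 'M[R]_m)
    (G := E *m E^T) :
  G \in unitmx -> A^T = A ->
  \tr (invmx G *m A *m (invmx G *m A)) = 0 -> A = 0.
Proof.
move=> uG symA tr0.
have symG : G^T = G by rewrite trmx_mul trmxK.
pose X := invmx G *m A *m invmx G; pose P := E^T *m X *m E.
have XG : X *m G = invmx G *m A by rewrite mulmxKV.
have symP : P^T = P.
  by rewrite /P /X !trmx_mul trmxK trmx_inv symG symA !mulmxA.
have P0 : P = 0.
  apply: mul_mx_tr_eq0; rewrite symP -tr0.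
  have -> : P *m P = E^T *m (X *m G *m X *m E) by rewrite /P /G !mulmxA.
  by rewrite mxtrace_mulC -[_ *m E *m _]mulmxA -/G -[_ *m X *m G]mulmxA XG.
have <- : E *m P *m E^T = A.
  have -> : E *m P *m E^T = G *m (X *m G) by rewrite /P /G !mulmxA.
  by rewrite XG mulKVmx.
by rewrite P0 mulmx0 mul0mx.
Qed.

(** Strict concavity of log det on positive definite matrices, in algebraic form.
    Dividing by det (E E^T) turns the determinant into det (1 + X M), to which
    the trace computation applies. *)
Lemma det_line_rigid (R : realFieldType) m n (E : 'M[R]_(m, n)) (A : 'M[R]_m)
    (p := \det (map_mx polyC (E *m E^T) + 'X *: map_mx polyC A)) :
  (forall y : 'rV_m, y *m E = 0 -> y = 0) -> A^T = A ->
  p`_1 = 0 -> p`_2 = 0 -> A = 0.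
Proof.
move=> injE symA p1 p2; have uG := gram_unit injE.
apply: (sym_trace_gram_eq0 uG symA); set G := E *m E^T in uG *.
have d0 : \det G != 0 by rewrite -unitfE -unitmxE.
have pE : p = \det G *: \det (1%:M + 'X *: map_mx polyC (invmx G *m A)).
  rewrite -mul_polyC -det_map_mx -det_mulmx mulmxDr mulmx1 -scalemxAr -map_mxM.
  by rewrite mulmxA mulmxV // mul1mx.
apply: mxtrace_sqr_eq0; apply/eqP; rewrite -(mulrI_eq0 _ (mulfI d0)) -coefZ -pE.
  by rewrite p1.
by rewrite p2.
Qed.

(** * Spanning trees *)

(** C is square and invertible over the integers, so its determinant is 1 or -1. *)
Lemma det_gram_left_inv m r (C : 'M[int]_(r, m)) (Y : 'M[int]_(m, r)) :
  m = r -> Y *m C = 1%:M -> \det (C *m C^T) = 1.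
Proof.
move=> eq_mr; case: _ / eq_mr in C Y * => /(congr1 determinant).
rewrite det1 !det_mulmx det_tr => /intUnitRing.unitzPl.
by rewrite qualifE => /pred2P[] ->.
Qed.

Section OrientedGraph.

Variables (V : finType) (n r : nat) (lab : 'I_n -> {set V}) (s t : 'I_n -> V).
Hypothesis lab_ends : forall i, lab i = [set s i; t i].
Hypothesis ends_neq : forall i, s i != t i.
Hypothesis lab_inj : injective lab.
Implicit Types (T : {set 'I_n}) (i j : 'I_n).

Local Notation adj T := (subgraph_rel lab T).
Local Notation conn T := (connected_graph (subgraph_rel lab T)).

Lemma adjP T x y :
  reflect (exists2 i, i \in T & [set x; y] = lab i) (adj T x y).
Proof. exact: imsetP. Qed.

Lemma adj_sym T : ssrbool.symmetric (adj T).
Proof. by move=> x y; rewrite /subgraph_rel /= finset.setUC. Qed.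

Lemma connect_adjC T : connect_sym (adj T).
Proof. exact/sym_connect_sym/adj_sym. Qed.

Lemma adj_ends T i : i \in T -> adj T (s i) (t i).
Proof. by move=> iT; apply/adjP; exists i => //; rewrite lab_ends. Qed.

Lemma set2_eq_cases (U : finType) (x y u v : U) : [set x; y] = [set u; v] ->
  (x = u /\ y = v) \/ (x = v /\ y = u).
Proof.
move=> e.
have : x \in [set u; v] by rewrite -e set21.
have : y \in [set u; v] by rewrite -e set22.
have : u \in [set x; y] by rewrite e set21.
have : v \in [set x; y] by rewrite e set22.
by rewrite !inE => /orP[]/eqP h1 /orP[]/eqP h2 /orP[]/eqP h3 /orP[]/eqP h4;
  subst; auto.
Qed.

Lemma adj_const (U : Type) (g : V -> U) T x y :
  (forall i, i \in T -> g (s i) = g (t i)) -> connect (adj T) x y -> g x = g y.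
Proof.
move=> gT /connectP[p + ->]; elim: p x => //= z p IH x /andP[/adjP[i iT xz] /IH <-].
by move: xz; rewrite lab_ends => /set2_eq_cases[[-> ->]|[-> ->]]; rewrite gT.
Qed.

Lemma adjD1_connect T i : i \in T -> connect (adj (T :\ i)) (s i) (t i) ->
  forall x y, connect (adj T) x y -> connect (adj (T :\ i)) x y.
Proof.
move=> iT sti; apply: connect_sub => x y /adjP[j jT xy].
have [eq_ji|neq_ji] := eqVneq j i; last first.
  by apply: connect1; apply/adjP; exists j; rewrite // !inE neq_ji.
move: xy; rewrite eq_ji lab_ends => /set2_eq_cases[[-> ->]|[-> ->]] //.
by rewrite connect_adjC.
Qed.

(** The first edge of the cycle is bypassed by the rest of the cycle. *)
Lemma cycle_not_bridge T (c : seq V) : cycle (adj T) c -> uniq c -> (2 < size c)%N ->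
  exists2 i, i \in T & connect (adj (T :\ i)) (s i) (t i).
Proof.
case: c => [|x [|y [|z c]]] //=.
rewrite !inE !negb_or => /andP[/adjP[i iT xy]] path_c.
move=> /andP[/and3P[xNy xNz xNc]] /andP[/andP[yNz yNc] /andP[zNc _]] _.
exists i => //.
suff cyx : connect (adj (T :\ i)) y x.
  by move: xy; rewrite lab_ends => /set2_eq_cases[[<- <-]|[<- <-]] //;
    rewrite connect_adjC.
have adjD u v : adj T u v -> [set u; v] != [set x; y] -> adj (T :\ i) u v.
  move=> /adjP[j jT uv] ne; apply/adjP; exists j => //.
  by rewrite !inE jT andbT; apply: contraNneq ne => e; rewrite uv e xy.
move: path_c => /andP[yz zc].
have yz' : adj (T :\ i) y z.
  apply: adjD yz _; apply/eqP => /set2_eq_cases[[e _]|[_ e]].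
    by rewrite e eqxx in xNy.
  by rewrite e eqxx in xNz.
apply: connect_trans (connect1 yz') _.
apply/connectP; exists (rcons c x); last by rewrite last_rcons.
have {yNc zNc} : y \notin z :: c by rewrite inE negb_or yNz.
elim: c z {yz yz' yNz xNz} xNc zc => [|u c IH] z /=.
  rewrite inE => _ /andP[zx _] yNz; rewrite andbT.
  apply: adjD zx _; apply/eqP => /set2_eq_cases[[_ e]|[e _]].
    by rewrite e eqxx in xNy.
  by rewrite e eqxx in yNz.
rewrite !inE !negb_or => /andP[xNu xNc] /andP[zu uc] /and3P[yNz yNu yNc].
rewrite IH ?inE ?negb_or ?yNu // andbT.
apply: adjD zu _; apply/eqP => /set2_eq_cases[[_ e]|[e _]].
  by rewrite e eqxx in yNu.
by rewrite e eqxx in yNz.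
Qed.

(** A simple path that bypasses the edge i closes up with i into a cycle.  This
    cycle has at least three vertices, since no other edge has the same ends. *)
Lemma not_bridge_cycle T i : i \in T -> connect (adj (T :\ i)) (s i) (t i) ->
  exists c, [&& cycle (adj T) c, uniq c & (2 < size c)%N].
Proof.
move=> iT /connectP[p0 p0T]; case/shortenP: p0T => p pT uniq_p _ lastp.
exists (s i :: p); rewrite uniq_p /=; apply/andP; split.
  rewrite rcons_path -lastp adj_sym adj_ends // andbT.
  apply: sub_path pT => x y /adjP[j]; rewrite inE => /andP[_ jT] e.
  by apply/adjP; exists j.
case: p {uniq_p} pT lastp => [_ /= e|x [|y p]] //=.
  by have := ends_neq i; rewrite e eqxx.
move=> /andP[/adjP[j]]; rewrite !inE => /andP[neq_ji _] e _ e'.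
by case/eqP: neq_ji; apply: lab_inj; rewrite -e lab_ends e'.
Qed.

Lemma acyclic_graphPn T :
  reflect (exists c, [&& cycle (adj T) c, uniq c & (2 < size c)%N])
          (~~ acyclic_graph (adj T)).
Proof.
apply: (iffP idP) => [|[c /and3P[cyc_c uniq_c size_c]]].
  case/forallPn=> k /forallPn[c]; rewrite negb_imply negbK => /andP[k2 /andP[h1 h2]].
  by exists c; rewrite h1 h2 size_tuple.
have lek : (size c < #|V|.+1)%N by rewrite ltnS -(card_uniqP uniq_c) max_card.
apply/forallPn; exists (Ordinal lek); apply/forallPn; exists (in_tuple c).
by rewrite negb_imply negbK size_c cyc_c uniq_c.
Qed.

Lemma connD1 T i : i \in T -> conn T ->
  conn (T :\ i) = connect (adj (T :\ i)) (s i) (t i).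
Proof.
move=> iT /forallP cT; apply/idP/idP => [/forallP/(_ (s i))/forallP -> //|h].
apply/forallP=> x; apply/forallP=> y; apply: adjD1_connect => //.
by have /forallP := cT x.
Qed.

(** A tree is a minimal connected graph.  In this form the definition no longer
    mentions cycles, and each edge of the tree yields a cut. *)
Lemma spanning_treeE T :
  spanning_tree lab T = conn T && [forall i in T, ~~ conn (T :\ i)].
Proof.
rewrite /spanning_tree /is_tree; case cT: (conn T) => //=.
apply/idP/forall_inP => [acT i iT|h].
  apply/negP; rewrite connD1 // => /(not_bridge_cycle iT)/acyclic_graphPn.
  by rewrite acT.
apply: contraT => /acyclic_graphPn[c /and3P[c1 c2 c3]].
have [i iT] := cycle_not_bridge c1 c2 c3; rewrite -connD1 // => hc.
by have := h i iT; rewrite hc.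
Qed.

(** * The reduced incidence matrix and the matrix-tree theorem *)

(** The root v0 is the vertex whose row is deleted; w enumerates the others. *)
Variables (v0 : V) (w : 'I_r -> V).
Hypothesis w_inj : injective w.
Hypothesis w_root : forall k, w k != v0.
Hypothesis w_onto : forall v, v != v0 -> exists k, v = w k.

Definition incidence (S : nzRingType) : 'M[S]_(r, n) :=
  \matrix_(k, i) ((w k == s i)%:R - (w k == t i)%:R).

(** A row vector is a potential on all the vertices, up to an additive constant:
    the normalisation at the root makes potential_row_incidence hold for every g,
    whatever its value at v0. *)
Definition potential_row (S : nzRingType) (g : V -> S) : 'rV[S]_r :=
  \row_k (g (w k) - g v0).

Lemma map_incidence (S S' : nzRingType) (f : {rmorphism S -> S'}) :
  map_mx f (incidence S) = incidence S'.
Proof. by apply/matrixP=> k i; rewrite !mxE rmorphB !rmorph_nat. Qed.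

Lemma potential_row_incidence (S : nzRingType) (g : V -> S) i :
  (potential_row g *m incidence S) 0 i = g (s i) - g (t i).
Proof.
have sum_delta v : \sum_k (g (w k) - g v0) * (w k == v)%:R = g v - g v0.
  have [->|/w_onto[l ->]] := eqVneq v v0.
    by rewrite subrr big1 // => k _; rewrite (negbTE (w_root k)) mulr0.
  rewrite (bigD1 l) //= eqxx mulr1 big1 ?addr0 // => k neq_kl.
  by rewrite (inj_eq w_inj) (negbTE neq_kl) mulr0.
rewrite mxE; under eq_bigr => k _ do rewrite !mxE mulrBr.
by rewrite sumrB !sum_delta opprB addrA subrK.
Qed.

Lemma incidence_potential (S : nzRingType) (y : 'rV[S]_r) :
  exists2 g : V -> S, g v0 = 0 & y = potential_row g.
Proof.
exists (fun v => \sum_(k | w k == v) y 0 k).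
  by rewrite big_pred0 // => k; rewrite (negbTE (w_root k)).
apply/rowP=> k; rewrite mxE (big_pred1 k); last by move=> l; rewrite /= (inj_eq w_inj).
by rewrite big_pred0 ?subr0 // => l; rewrite (negbTE (w_root l)).
Qed.

Lemma conn_incidence_ker (S : nzRingType) T (y : 'rV[S]_r) : conn T ->
  (forall i, i \in T -> (y *m incidence S) 0 i = 0) -> y = 0.
Proof.
move=> cT; have [g g0 ->] := incidence_potential y => yT.
apply/rowP=> k; rewrite !mxE; apply/eqP; rewrite subr_eq0; apply/eqP.
have /forallP/(_ v0) := forallP cT (w k).
apply: adj_const => i iT; apply/eqP.
by rewrite -subr_eq0 -potential_row_incidence yT.
Qed.

(** The columns of the edges of a connected graph span the whole space. *)
Lemma conn_card T : conn T -> (r <= #|T|)%N.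
Proof.
move=> cT; pose M : 'M[rat]_(r, #|T|) := colsub enum_val (incidence rat).
suff /eqP <- : row_free M by apply: rank_leq_col.
rewrite -kermx_eq0; apply/eqP/row_matrixP=> k; rewrite row0.
apply: (conn_incidence_ker cT) => i iT.
have : (row k (kermx M) *m M) 0 (enum_rank_in iT i) = 0.
  by rewrite -row_mul mulmx_ker row0 mxE.
rewrite !mxE => e; rewrite -[RHS]e; apply: eq_bigr => l _.
by rewrite !mxE enum_rankK_in.
Qed.

(** Removing an edge of a tree cuts the vertices into two sides; the indicator of
    one side is a potential that varies along this edge only.  Hence the
    columns of the edges of a tree are independent, with an integral dual
    family. *)
Lemma tree_dual_potentials (S : nzRingType) T : spanning_tree lab T ->
  exists Y : 'M[S]_(#|T|, r), Y *m colsub enum_val (incidence S) = 1%:M.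
Proof.
rewrite spanning_treeE => /andP[cT /forall_inP bridge].
pose g j v : S := (connect (adj (T :\ j)) (s j) v)%:R.
pose Y : 'M[S]_(#|T|, r) := \matrix_(l < #|T|) potential_row (g (enum_val l)).
exists Y; apply/matrixP=> l m.
have -> : (Y *m colsub enum_val (incidence S)) l m =
    (potential_row (g (enum_val l)) *m incidence S) 0 (enum_val m).
  by rewrite !mxE; apply: eq_bigr => k _; rewrite !mxE.
rewrite potential_row_incidence mxE; have [->|neq_lm] := eqVneq l m.
  have lT : enum_val m \in T by apply: enum_valP.
  have := bridge _ lT; rewrite connD1 // /g connect0 => /negbTE ->.
  by rewrite subr0.
apply/eqP; rewrite subr_eq0 /g; apply/eqP; congr (_%:R); congr (nat_of_bool _).
apply: same_connect_r; first exact: connect_adjC.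
apply/connect1/adj_ends; rewrite !inE enum_valP andbT.
by rewrite (inj_eq enum_val_inj) eq_sym.
Qed.

Lemma tree_card T : spanning_tree lab T -> #|T| = r.
Proof.
move=> tT; apply/eqP; rewrite eqn_leq conn_card ?andbT; last by case/andP: tT.
have [Y YN] := tree_dual_potentials rat tT.
by rewrite -(mxrank1 rat #|T|) -YN (leq_trans (mxrankM_maxr _ _)) ?rank_leq_row.
Qed.

(** For a tree the minor is the Gram determinant of a unimodular matrix.  If T is
    not a tree, either T is disconnected, and the indicator of the component of
    the root is in the kernel, or T contains an edge that can be removed without
    disconnecting the graph, and then T has more than r edges. *)
Lemma det_laplacian_minor T : #|T| = r ->
  \det (incidence int *m diag_mx (indic_row int T) *m (incidence int)^T) =
  (spanning_tree lab T)%:R.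
Proof.
move=> cardT; set N := incidence int.
case tT: (spanning_tree lab T); rewrite /=.
  have [Y YN] := tree_dual_potentials int tT.
  rewrite -(det_gram_left_inv (tree_card tT) YN); congr (\det _).
  apply/matrixP=> k l; rewrite !mxE.
  under eq_bigr => i _ do rewrite mul_mx_diag !mxE -mulrA mulrCA mulr_natl mulrb.
  rewrite -big_mkcond big_enum_val /=.
  by apply: eq_bigr => m _; rewrite !mxE.
have [/eqP|det_neq0] := eqVneq (\det (N *m diag_mx (indic_row int T) *m N^T)) 0.
  by move/eqP.
have cT : conn T.
  apply: contraR det_neq0 => ncT.
  have [v nv] : exists v, ~~ connect (adj T) v0 v.
    apply/existsP; apply: contraR ncT => /existsPn h.
    apply/forallP=> x; apply/forallP=> y.
    apply: (@connect_trans _ _ v0); first rewrite connect_adjC.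
      by have := h x; rewrite negbK.
    by have := h y; rewrite negbK.
  pose g u : int := (connect (adj T) v0 u)%:R.
  apply/det0P; exists (potential_row g).
    have /w_onto[k vk] : v != v0 by apply: contraNneq nv => ->; rewrite connect0.
    apply/eqP => /rowP/(_ k); rewrite !mxE -vk /g connect0 (negbTE nv).
    by [].
  suff -> : potential_row g *m (N *m diag_mx (indic_row int T) *m N^T) = 0 by [].
  rewrite !mulmxA [_ *m diag_mx _](_ : _ = 0) ?mul0mx //.
  apply/rowP=> i; rewrite mul_mx_diag mxE potential_row_incidence !mxE.
  case iT: (i \in T); rewrite ?mulr0 // mulr1; apply/eqP; rewrite subr_eq0 /g.
  apply/eqP; congr (_%:R); congr (nat_of_bool _).
  by apply: same_connect_r; [exact: connect_adjC | exact/connect1/adj_ends].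
have [i iT /conn_card] : exists2 i, i \in T & conn (T :\ i).
  move: tT; rewrite spanning_treeE cT /= => /negbT/forall_inPn[i iT].
  by rewrite negbK; exists i.
by rewrite -ltnS -[#|_|.+1]/(true + _)%N -iT -cardsD1 cardT ltnn.
Qed.

Lemma matrix_tree (S : comNzRingType) (x : 'I_n -> S) :
  \sum_(T | spanning_tree lab T) \prod_(i in T) x i =
  \det (incidence S *m diag_mx (\row_i x i) *m (incidence S)^T).
Proof.
have minor T : #|T| == r ->
    \det (incidence S *m diag_mx (indic_row S T) *m (incidence S)^T) =
    (spanning_tree lab T)%:R.
  move=> /eqP/det_laplacian_minor/(congr1 (intr : int -> S)).
  rewrite rmorph_nat -det_map_mx !map_mxM map_diag_mx -map_trmx map_incidence => <-.
  by congr (\det (_ *m diag_mx _ *m _)); apply/rowP=> i; rewrite !mxE rmorph_nat.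
rewrite cauchy_binet_diag big_mkcond [RHS]big_mkcond; apply: eq_bigr => T _ /=.
case tT: (spanning_tree lab T).
  rewrite tree_card // eqxx minor ?tree_card // tT mulr1.
  by apply: eq_bigr => i _; rewrite mxE.
by case: eqP => // /eqP/minor ->; rewrite tT mulr0.
Qed.

(** The rank-one Laplacians of the edges are linearly independent: evaluated at
    the indicators of the two ends of i, the bilinear form of the weighted
    Laplacian is - x i, since no other edge joins these two vertices. *)
Lemma laplacian_inj (S : comNzRingType) (x : 'I_n -> S) :
  incidence S *m diag_mx (\row_i x i) *m (incidence S)^T = 0 -> forall i, x i = 0.
Proof.
move=> L0 i.
pose g (u v : V) : S := (v == u)%:R.
have form h h' : \sum_j (h (s j) - h (t j)) * x j * (h' (s j) - h' (t j)) = 0.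
  transitivity ((potential_row h *m
      (incidence S *m diag_mx (\row_j x j) *m (incidence S)^T) *m
      (potential_row h')^T) 0 0); last by rewrite L0 mulmx0 mul0mx mxE.
  rewrite !mulmxA -mulmxA -trmx_mul mxE; apply: eq_bigr => j _.
  by rewrite mul_mx_diag mxE [_^T j 0]mxE !potential_row_incidence mxE.
have := form (g (s i)) (g (t i)); rewrite (bigD1 i) //= big1 ?addr0 => [|j neq_ji].
  rewrite /g !eqxx (negbTE (ends_neq i)) eq_sym (negbTE (ends_neq i)).
  by rewrite subr0 sub0r mul1r mulrN1 => /eqP; rewrite oppr_eq0 => /eqP.
have h u : (s j == u) || (t j == u) = (u \in lab j).
  by rewrite lab_ends !inE ![_ == u]eq_sym.
have : ~~ ((s i \in lab j) && (t i \in lab j)).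
  apply: contra neq_ji => /andP[]; rewrite lab_ends !inE => hs ht.
  apply/eqP/lab_inj; rewrite !lab_ends.
  have := ends_neq i; move: hs ht => /orP[]/eqP-> /orP[]/eqP->; rewrite ?eqxx // => _.
  exact: finset.setUC.
rewrite -!h /g negb_and !negb_or => /orP[]/andP[/negbTE-> /negbTE->].
  by rewrite subrr !mul0r.
by rewrite subrr mulr0.
Qed.

End OrientedGraph.

(** * Homogeneous polynomials as differential operators *)

Section Homogeneous.
Variables (R : comNzRingType) (n : nat).
Implicit Types (F P Q : {mpoly R[n]}) (b : 'I_n -> R).

Definition lform b : {mpoly R[n]} := \sum_i b i *: 'X_i.

Lemma dhomog_coefP d P :
  (forall m, mdeg m != d -> P@_m = 0) -> P \is d.-homog.
Proof.
move=> h; apply/dhomogP => m; rewrite mcoeff_msupp => Pm.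
by apply/eqP; apply: contraNT Pm => /h ->.
Qed.

Lemma lform_homog b : lform b \is 1.-homog.
Proof. by apply: rpred_sum => i _; rewrite rpredZ // dhomogX /= mdeg1. Qed.

Lemma dhomog1_lform P : P \is 1.-homog -> P = lform (fun i => P@_U_(i)).
Proof.
move=> hP; apply/mpolyP => m.
have [/mdeg1P[i /eqP->]|hm] := boolP (mdeg m == 1%N); last first.
  by rewrite !(dhomog_nemf_coeff _ hm) // lform_homog.
rewrite /lform raddf_sum /= (bigD1 i) //= mcoeffZ mcoeffXU eqxx mulr1 big1 ?addr0 //.
by move=> j /negbTE ne; rewrite mcoeffZ mcoeffXU ne mulr0.
Qed.

Lemma lform_comb b c (t : R) : lform (fun i => b i + c i * t) = lform b + t *: lform c.
Proof.
rewrite /lform scaler_sumr -big_split; apply: eq_bigr => i _ /=.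
by rewrite scalerDl scalerA mulrC.
Qed.

Lemma mderiv_homog d F i : F \is d.+1.-homog -> F^`M(i) \is d.-homog.
Proof.
move=> hF; apply: dhomog_coefP => m hm; rewrite mcoeff_mderiv.
by rewrite (dhomog_nemf_coeff hF) ?mul0rn //= mdegD mdeg1 addn1 eqSS.
Qed.

Lemma diffop_homog k d F Q :
  F \is (d + k).-homog -> Q \is k.-homog -> diffop F Q \is d.-homog.
Proof.
move=> hF hQ; rewrite /diffop big_seq; apply: rpred_sum => m mQ; apply: rpredZ.
apply: dhomog_coefP => m' hm'; rewrite mcoeff_mderivm.
rewrite (dhomog_nemf_coeff hF) ?mul0rn //= mdegD (dhomogP _ _ _ hQ) //.
by rewrite addnC eqn_add2r.
Qed.

Lemma diffop_lform F b : diffop F (lform b) = \sum_i b i *: F^`M(i).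
Proof.
rewrite /lform raddf_sum; apply: eq_bigr => i _.
by rewrite /= linearZ /= diffopX mderivmU1m.
Qed.

Lemma euler_homog d F b :
  F \is d.-homog -> (\sum_i b i *: F^`M(i)).@[b] = d%:R * F.@[b].
Proof.
move=> hF.
have eulerX m : (\sum_i b i *: ('X_[m] : {mpoly R[n]})^`M(i)).@[b] =
    (mdeg m)%:R * ('X_[m] : {mpoly R[n]}).@[b].
  rewrite raddf_sum mdegE natr_sum mulr_suml; apply: eq_bigr => i _ /=.
  rewrite mevalZ mderivX mevalZ !mevalX; case mi: (m i) => [|k].
    by rewrite !mul0r mulr0.
  rewrite mulrCA; congr (_ * _); rewrite (bigD1 i) //= [RHS](bigD1 i) //= mulrA.
  rewrite mnmBE mnm1E eqxx mi subn1 -exprS; congr (_ * _).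
  by apply: eq_bigr => j /negbTE ne; rewrite mnmBE mnm1E eq_sym ne subn0.
have -> : \sum_i b i *: F^`M(i) =
    \sum_(m <- msupp F) F@_m *: \sum_i b i *: ('X_[m] : {mpoly R[n]})^`M(i).
  under [RHS]eq_bigr => m _ do rewrite scaler_sumr.
  rewrite exchange_big; apply: eq_bigr => i _; rewrite [F in LHS]mpolyE.
  rewrite (raddf_sum (mderiv i)) scaler_sumr; apply: eq_bigr => m _ /=.
  by rewrite linearZ /= !scalerA mulrC.
rewrite [F in RHS]mpolyE !raddf_sum /= mulr_sumr; apply: eq_big_seq => m mF.
by rewrite !mevalZ eulerX mulrCA -(dhomogP _ _ _ hF m mF).
Qed.

(** Iterating Euler's identity: each application of the derivation along b lowers
    the degree by one and multiplies the value at b by the degree. *)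
Lemma diffop_lform_exp d F b :
  F \is d.-homog -> (diffop F (lform b ^+ d))@_0%MM = d`!%:R * F.@[b].
Proof.
elim: d F => [|d IH] F hF.
  rewrite expr0 fact0 mul1r -mpolyX0 diffopX mderivm0m.
  rewrite mevalE [in LHS](mpolyE F) (raddf_sum (mcoeff 0%MM)) /=.
  apply: eq_big_seq => m mF; have /eqP := dhomogP _ _ _ hF m mF.
  rewrite mdeg_eq0 => /eqP m0.
  rewrite mcoeffZ mcoeffX m0 eqxx; congr (_ * _).
  by rewrite big1 // => i _; rewrite mnm0E expr0.
rewrite exprSr diffopM IH; last first.
  by rewrite diffop_lform; apply: rpred_sum => i _; rewrite rpredZ // mderiv_homog.
by rewrite diffop_lform (euler_homog _ hF) factS natrM mulrA (mulrC d.+1%:R).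
Qed.

End Homogeneous.

Lemma horner_inj_num (R : numDomainType) (p q : {poly R}) :
  (forall t, p.[t] = q.[t]) -> p = q.
Proof.
move=> h; apply/eqP; rewrite -subr_eq0; apply: contraT => nz.
have := max_poly_roots (rs := [seq k%:R | k <- iota 0 (size (p - q))]) nz.
rewrite size_map size_iota ltnn => -> //.
  by apply/allP=> x _; rewrite rootE hornerD hornerN h subrr.
by rewrite map_inj_uniq ?iota_uniq // => i j /eqP; rewrite eqr_nat => /eqP.
Qed.

(** Expanding (ell_a + t ell_x)^r by the binomial theorem, the coefficient of t^j
    in r! F(a + t x) is, up to a binomial factor, the effect on F of
    ell_a^(r-j) * ell_x^j, a multiple of ell_x * ell_a^(r-2) for j = 1, 2. *)
Lemma line_coefs_eq0 (R : numFieldType) n r (F : {mpoly R[n]})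
    (a x : 'I_n -> R) (p : {poly R}) :
  F \is r.-homog -> (2 <= r)%N -> diffop F (lform x * lform a ^+ (r - 2)) = 0 ->
  (forall t, p.[t] = F.@[fun i => a i + x i * t]) -> p`_1 = 0 /\ p`_2 = 0.
Proof.
move=> hF r2 F0 pE.
pose c j := (diffop F (lform a ^+ (r - j) * lform x ^+ j))@_0%MM.
have qE : r`!%:R *: p = \poly_(j < r.+1) ('C(r, j)%:R * c j).
  apply: horner_inj_num => t; rewrite hornerZ pE -diffop_lform_exp // lform_comb exprDn.
  rewrite horner_poly (raddf_sum (diffop F)) (raddf_sum (mcoeff 0%MM)) /=.
  apply: eq_bigr => j _.
  rewrite raddfMn /= exprZn -scalerAr linearZ mcoeffMn mcoeffZ.
  by rewrite -[RHS]mulrA mulr_natl; congr (_ *+ _); exact: mulrC.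
have c1 : c 1%N = 0.
  rewrite /c -(subnSK r2) exprS expr1 -mulrA [_ * lform x]mulrC diffopM F0.
  by rewrite /diffop big1 ?mcoeff0 // => m _; rewrite linear0 scaler0.
have c2 : c 2 = 0.
  rewrite /c expr2 mulrA mulrC -[lform a ^+ _ * _]mulrC diffopM F0.
  by rewrite /diffop big1 ?mcoeff0 // => m _; rewrite linear0 scaler0.
have f0 : r`!%:R != 0 :> R by rewrite pnatr_eq0 -lt0n fact_gt0.
by split; apply: (mulfI f0); rewrite mulr0 -coefZ qE coef_poly ?c1 ?c2 mulr0 if_same.
Qed.

(** * The Lefschetz property and the Hessian *)

(** For F of degree r, the matrix H below is (r-2)! times the Hessian of F at a.
    The hypothesis says that it has no kernel, so that H is invertible, and the
    classes of degree r-1 embed by their action on F into the linear forms,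
    that is, into the row vectors reached by H. *)
Lemma lefschetz_of_hessian (R : fieldType) n r (F : {mpoly R[n]}) (a : 'I_n -> R) :
  F \is r.-homog -> (2 <= r)%N ->
  (forall x, diffop F (lform x * lform a ^+ (r - 2)) = 0 -> forall i, x i = 0) ->
  set_bij (apolar_part F 1%N) (apolar_part F r.-1)
    (mulmap (linear_form F a ^+ (r - 2))).
Proof.
move=> hF r2 nondeg.
have mulE P : mulmap (linear_form F a ^+ (r - 2)) (apolar_proj F P) =
    apolar_proj F (P * lform a ^+ (r - 2)).
  by rewrite mulrC rmorphM rmorphXn.
have homL : lform a ^+ (r - 2) \is (r - 2).-homog.
  by have := dhomogMn (r - 2) (lform_homog a); rewrite mul1n.
have homPL P : P \is 1.-homog -> P * lform a ^+ (r - 2) \is r.-1.-homog.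
  by move=> hP; have := dhomogM hP homL; rewrite add1n subn2
    prednK // -ltnS prednK // ltnW.
have hF' : F \is (1 + r.-1).-homog by rewrite add1n prednK // ltnW.
have lformB x y : lform x - lform y = lform (fun i => x i - y i) :> {mpoly R[n]}.
  by rewrite /lform -sumrB; apply: eq_bigr => i _; rewrite scalerBl.
split.
- move=> _ [P /= hP <-]; rewrite mulE; exists (P * lform a ^+ (r - 2)) => //=.
  exact: homPL.
- move=> u v; rewrite !inE => -[P /= hP <-] [Q /= hQ <-]; rewrite !mulE => /eqP.
  rewrite apolar_proj_eq -mulrBl unfold_in => /eqP h; congr apolar_proj.
  move: h; rewrite (dhomog1_lform hP) (dhomog1_lform hQ) lformB => /nondeg h.
  by apply: eq_bigr => i _; congr (_ *: _); apply/eqP; rewrite -subr_eq0 h.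
move=> _ [Q /= hQ <-].
pose H := \matrix_(i, j) (diffop F ('X_i * lform a ^+ (r - 2)))@_U_(j).
have HE (x : 'I_n -> R) j :
    (diffop F (lform x * lform a ^+ (r - 2)))@_U_(j) = ((\row_i x i) *m H) 0 j.
  rewrite mxE /lform mulr_suml (raddf_sum (diffop F)) (raddf_sum (mcoeff U_(j)%MM)) /=.
  apply: eq_bigr => i _.
  by rewrite !mxE -scalerAl linearZ mcoeffZ.
have uH : H \in unitmx.
  rewrite -row_free_unit -kermx_eq0; apply/eqP/row_matrixP=> k; rewrite row0.
  apply/rowP=> i; rewrite [RHS]mxE.
  apply: (nondeg (fun i => row k (kermx H) 0 i)).
  rewrite [LHS](dhomog1_lform (diffop_homog hF' (homPL _ (lform_homog _)))).
  rewrite /lform big1 // => j _; rewrite HE.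
  rewrite (_ : \row_i _ = row k (kermx H)) -?row_mul ?mulmx_ker ?row0 ?mxE ?scale0r //.
  by apply/rowP=> l; rewrite mxE.
pose y := \row_j (diffop F Q)@_U_(j) *m invmx H.
exists (apolar_proj F (lform (fun i => y 0 i))).
  by exists (lform (fun i => y 0 i)); rewrite //= lform_homog.
rewrite mulE; apply/eqP; rewrite apolar_proj_eq unfold_in linearB subr_eq0 /=; apply/eqP.
rewrite [LHS](dhomog1_lform (diffop_homog hF' (homPL _ (lform_homog _)))).
rewrite [RHS](dhomog1_lform (diffop_homog hF' hQ)).
apply: eq_bigr => j _; congr (_ *: _); rewrite HE.
by rewrite (_ : \row_i _ = y) ?mulmxKV ?mxE //; apply/rowP=> l; rewrite mxE.
Qed.

(** * The Kirchhoff polynomial *)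

Section KirchhoffPolynomial.
Variables (V : finType) (n r : nat) (lab : 'I_n -> {set V}) (s t : 'I_n -> V).
Hypothesis lab_ends : forall i, lab i = [set s i; t i].
Hypothesis ends_neq : forall i, s i != t i.
Hypothesis lab_inj : injective lab.

Variables (v0 : V) (w : 'I_r -> V).
Hypothesis w_inj : injective w.
Hypothesis w_root : forall k, w k != v0.
Hypothesis w_onto : forall v, v != v0 -> exists k, v = w k.

Lemma kirchhoff_meval (R : comNzRingType) (x : 'I_n -> R) :
  (kirchhoff R lab).@[x] = \sum_(T | spanning_tree lab T) \prod_(i in T) x i.
Proof.
rewrite rmorph_sum; apply: eq_bigr => T _ /=.
by rewrite rmorph_prod; apply: eq_bigr => i _; rewrite /= mevalXU.
Qed.

Lemma kirchhoff_homog (R : comNzRingType) : kirchhoff R lab \is r.-homog.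
Proof.
apply: rpred_sum => T tT; rewrite mprodXE dhomogX /= mdeg_sum.
under eq_bigr => i _ do rewrite mdeg1.
by rewrite sum1_card (tree_card lab_ends ends_neq lab_inj w_inj w_root w_onto tT).
Qed.

(** The square roots of the weights exhibit B diag(a) B^T as a Gram matrix; the
    rows of B are independent because the graph is connected. *)
Lemma kirchhoff_nondegenerate (R : rcfType) (a x : 'I_n -> R) :
  (2 <= r)%N -> (forall i, 0 < a i) ->
  connected_graph (subgraph_rel lab [set: 'I_n]) ->
  diffop (kirchhoff R lab) (lform x * lform a ^+ (r - 2)) = 0 -> forall i, x i = 0.
Proof.
move=> r2 a_gt0 conn_lab F0.
pose B := incidence s t w R.
pose E := B *m diag_mx (\row_i Num.sqrt (a i)).
pose A := B *m diag_mx (\row_i x i) *m B^T.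
suff A0 : A = 0.
  by apply: (laplacian_inj lab_ends ends_neq lab_inj w_inj w_root w_onto A0).
have injE (y : 'rV_r) : y *m E = 0 -> y = 0.
  move=> yE0; apply: (conn_incidence_ker lab_ends w_inj w_root w_onto conn_lab) => i _.
  have /rowP/(_ i) := yE0; rewrite mulmxA mul_mx_diag mxE [RHS]mxE => /eqP.
  have : Num.sqrt (a i) != 0 by rewrite gt_eqF ?sqrtr_gt0.
  by rewrite [(\row__ _) 0 i]mxE mulf_eq0 => /negbTE ->; rewrite orbF => /eqP.
have symA : A^T = A by rewrite !trmx_mul trmxK tr_diag_mx mulmxA.
pose p := \sum_(T | spanning_tree lab T) \prod_(i in T) ((a i)%:P + (x i)%:P * 'X).
have pE u : p.[u] = (kirchhoff R lab).@[fun i => a i + x i * u].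
  rewrite kirchhoff_meval horner_sum; apply: eq_bigr => T _.
  by rewrite horner_prod; apply: eq_bigr => i _; rewrite !hornerE.
have [p1 p2] := line_coefs_eq0 (kirchhoff_homog R) r2 F0 pE.
have p_det : p = \det (map_mx polyC (E *m E^T) + 'X *: map_mx polyC A).
  rewrite /p (matrix_tree lab_ends ends_neq lab_inj w_inj w_root w_onto).
  rewrite -(map_incidence s t w (polyC : {rmorphism R -> {poly R}})) -/B.
  have -> : E *m E^T = B *m diag_mx (\row_i a i) *m B^T.
    rewrite trmx_mul tr_diag_mx !mulmxA -[_ *m diag_mx _ *m diag_mx _]mulmxA mulmx_diag.
    congr (_ *m diag_mx _ *m _); apply/rowP=> i.
    by rewrite !mxE -expr2 sqr_sqrtr // ltW.
  rewrite !map_mxM !map_diag_mx -map_trmx scalemxAl -mulmxDl scalemxAr -mulmxDr.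
  rewrite -linearZ -linearD /=; congr (\det (_ *m diag_mx _ *m _)).
  by apply/rowP=> i; rewrite !mxE mulrC.
by apply: (det_line_rigid injE symA); rewrite -p_det.
Qed.
End KirchhoffPolynomial.

Lemma edge_labelling_ends (V : finType) (e : rel V) n (lab : 'I_n -> {set V}) :
  irreflexive e -> edge_labelling e lab ->
  exists s t : 'I_n -> V, forall i, lab i = [set s i; t i] /\ s i != t i.
Proof.
move=> irr [_ labE].
have ends i : exists q : V * V, lab i = [set q.1; q.2] /\ q.1 != q.2.
  have : lab i \in edge_set e by rewrite -labE imset_f.
  case/imsetP=> -[u v]; rewrite inE /= => euv ->; exists (u, v); split=> //=.
  by apply: contraTneq euv => ->; rewrite irr.
have [q qP] := fin_all_exists ends.
by exists (fst \o q), (snd \o q).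
Qed.

Lemma edge_labelling_adj (V : finType) (e : rel V) n (lab : 'I_n -> {set V}) :
  edge_labelling e lab ->
  connected_graph e -> connected_graph (subgraph_rel lab [set: 'I_n]).
Proof.
move=> [_ labE] /forallP conn_e; apply/forallP=> u; apply/forallP=> v.
have /forallP/(_ v) := conn_e u; apply: connect_sub => y z eyz; apply: connect1.
have : [set y; z] \in edge_set e by apply/imsetP; exists (y, z); rewrite ?inE.
rewrite -labE /subgraph_rel /=; case/imsetP=> i _ ->.
by apply: imset_f; rewrite inE.
Qed.

Lemma rooted_enum (V : finType) r : #|V| = r.+1 ->
  exists (v0 : V) (w : 'I_r -> V), [/\ injective w, forall k, w k != v0 &
    forall v, v != v0 -> exists k, v = w k].
Proof.
move=> cV.
have cV' : r.+1 = #|{: V}| by rewrite -cV.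
pose f k : V := enum_val (cast_ord cV' k).
have f_inj : injective f by move=> k l /enum_val_inj/cast_ord_inj.
exists (f ord0), (fun k => f (lift ord0 k)); split.
- by move=> k l /f_inj/lift_inj.
- by move=> k; rewrite (inj_eq f_inj) eq_sym neq_lift.
move=> v; have -> : v = f (cast_ord (esym cV') (enum_rank v)).
  by rewrite /f cast_ordKV enum_rankK.
set k := cast_ord _ _; rewrite (inj_eq f_inj) eq_sym => /unlift_some[l kE _].
by exists l; rewrite kE.
Qed.

Theorem theorem1p2 (R : realType) (V : finType) (e : rel V) (r n : nat)
    (lab : 'I_n -> {set V}) (a : 'I_n -> R) :
  ssrbool.symmetric e -> irreflexive e -> connected_graph e ->
  edge_labelling e lab ->
  #|V| = r.+1 -> (2 <= r)%N ->
  (forall i : 'I_n, 0 < a i) ->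
  set_bij (apolar_part (kirchhoff R lab) 1%N)
          (apolar_part (kirchhoff R lab) r.-1)
          (mulmap (linear_form (kirchhoff R lab) a ^+ (r - 2))).
Proof.
move=> _ irr_e conn_e labP cardV r2 a_gt0.
have [v0 [w [w_inj w_root w_onto]]] := rooted_enum cardV.
have [s [t ends]] := edge_labelling_ends irr_e labP.
have lab_ends i : lab i = [set s i; t i] by case: (ends i).
have ends_neq i : s i != t i by case: (ends i).
have lab_inj : injective lab by case: labP.
apply: lefschetz_of_hessian => // [|x].
  exact: (kirchhoff_homog lab_ends ends_neq lab_inj w_inj w_root w_onto).
apply: (kirchhoff_nondegenerate lab_ends ends_neq lab_inj w_inj w_root w_onto) => //.
exact: edge_labelling_adj labP conn_e.
Qed.
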